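(* Let $\mathcal G$ be a nilpotent finite dimensional Lie algebra over a field $K$ of characteristic zero, let $A$ be a noncommutative prime factor ring of its universal enveloping algebra $U(\mathcal G)$, and let $a\in A$ be an arbitrary element. Then, for an arbitrary polynomial $f(t)\in K[t]$ of degree $>1$, $0$ is the only eigenvalue of the inner derivation $\operatorname{ad} f(a)$ of $A$; that is, if $[f(a),b]=\lambda b$ for some $\lambda\in K$ and $0\ne b\in A$, then $\lambda=0$.
   Context: A prime factor ring of $U(\mathcal G)$ is a quotient $U(\mathcal G)/P$ by a prime two-sided ideal $P$. $\operatorname{ad} u$ is the inner derivation $b\mapsto[u,b]=ub-bu$. *)

(* Defs.v *)
From HB Require Import structures.
From mathcomp Require Import all_boot all_algebra.
From mathcomp Require Import finmap monalg.
From mathcomp Require Import boolp.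

Set Implicit Arguments.
Unset Strict Implicit.
Unset Printing Implicit Defensive.

Import GRing.Theory.
Local Open Scope ring_scope.
Local Open Scope quotient_scope.

Definition two_sided (R : nzRingType) (I : {pred R}) : Prop :=
  [/\ zmod_closed I,
      forall a u, u \in I -> a * u \in I
    & forall a u, u \in I -> u * a \in I].

(* [idealr] of ring_quotient.v only asks for closure under multiplication on
   the left; like [idealr], the ideals below are proper. *)
HB.mixin Record isRightMulClosed (R : nzRingType) (S : R -> bool) := {
  ideal2_right_subproof : forall a u : R, u \in S -> u * a \in S
}.

#[short(type="ideal2")]
HB.structure Definition Ideal2 (R : nzRingType) :=
  {S of Idealr R S & isRightMulClosed R S}.

Definition prime_ideal (R : nzRingType) (P : ideal2 R) : Prop :=
  forall I J : {pred R}, two_sided I -> two_sided J ->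
    (forall x y, x \in I -> y \in J -> x * y \in (P : {pred R})) ->
    {subset I <= (P : {pred R})} \/ {subset J <= (P : {pred R})}.

(* The additive quotient is the one of ring_quotient.v; the product there
   requires a commutative ring, hence this alias, which carries the algebra
   structure. *)
Definition alg_quot (K : fieldType) (A : algType K) (I : ideal2 A) : Type :=
  Quotient.quot I.

Section AlgQuot.
Variables (K : fieldType) (A : algType K) (I : ideal2 A).
Local Notation Q := (alg_quot I).

HB.instance Definition _ := GRing.Zmodule.on Q.
HB.instance Definition _ := EqQuotient.on Q.

Definition quot_proj (x : A) : Q := \pi_Q x.

Lemma quot_proj_repr (x : Q) : quot_proj (repr x) = x.
Proof. exact: reprK. Qed.

Lemma quot_projE (x y : A) :
  (quot_proj x == quot_proj y) = (x - y \in (I : {pred A})).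
Proof. by rewrite (Quotient.idealrBE I). Qed.

Lemma quot_projD : {morph quot_proj : x y / x + y}.
Proof. exact: Quotient.pi_add. Qed.

Lemma quot_projB : {morph quot_proj : x y / x - y}.
Proof.
move=> x y; rewrite quot_projD; congr (_ + _).
exact: (@Quotient.pi_opp _ I).
Qed.

Let ideal2Ml a u : u \in (I : {pred A}) -> a * u \in (I : {pred A}).
Proof. exact: idealMr. Qed.

Let ideal2Mr a u : u \in (I : {pred A}) -> u * a \in (I : {pred A}).
Proof. exact: ideal2_right_subproof. Qed.

Definition quot_one : Q := quot_proj 1.
Definition quot_mul (x y : Q) : Q := quot_proj (repr x * repr y).
Definition quot_scale (c : K) (x : Q) : Q := quot_proj (c *: repr x).

Let repr_proj x : repr (quot_proj x) - x \in (I : {pred A}).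
Proof. by rewrite -quot_projE quot_proj_repr. Qed.

Lemma quot_projM x y : quot_proj (x * y) = quot_mul (quot_proj x) (quot_proj y).
Proof.
apply/esym/eqP; rewrite quot_projE.
set u := repr (quot_proj x); set v := repr (quot_proj y).
have -> : u * v - x * y = (u - x) * v + x * (v - y).
  by rewrite mulrBl mulrBr addrA subrK.
by rewrite rpredD //; [apply: ideal2Mr | apply: ideal2Ml]; apply: repr_proj.
Qed.

Lemma quot_projZ c x : quot_proj (c *: x) = quot_scale c (quot_proj x).
Proof.
apply/esym/eqP; rewrite quot_projE -scalerBr -mulr_algl.
exact/ideal2Ml/repr_proj.
Qed.

Let quotP (T : Q -> Prop) : (forall x, T (quot_proj x)) -> forall x, T x.
Proof. by move=> h x; rewrite -[x]quot_proj_repr. Qed.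

Fact quot_mulA : associative quot_mul.
Proof.
by do 3![elim/quotP=> ?]; rewrite -!quot_projM mulrA.
Qed.

Fact quot_mul1 : left_id quot_one quot_mul.
Proof. by elim/quotP=> ?; rewrite -quot_projM mul1r. Qed.

Fact quot_mulr1 : right_id quot_one quot_mul.
Proof. by elim/quotP=> ?; rewrite -quot_projM mulr1. Qed.

Fact quot_mulDl : left_distributive quot_mul +%R.
Proof.
by do 3![elim/quotP=> ?]; rewrite -quot_projD -!quot_projM mulrDl quot_projD.
Qed.

Fact quot_mulDr : right_distributive quot_mul +%R.
Proof.
by do 3![elim/quotP=> ?]; rewrite -quot_projD -!quot_projM mulrDr quot_projD.
Qed.

Fact quot_one_neq0 : quot_one != 0 :> Q.
Proof.
have -> : 0 = quot_proj 0 :> Q by rewrite -[X in quot_proj X](subrr 0) quot_projB subrr.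
by rewrite quot_projE subr0 idealr1.
Qed.

HB.instance Definition _ := GRing.Zmodule_isNzRing.Build Q
  quot_mulA quot_mul1 quot_mulr1 quot_mulDl quot_mulDr quot_one_neq0.

Fact quot_scaleA a b (x : Q) :
  quot_scale a (quot_scale b x) = quot_scale (a * b) x.
Proof. by elim/quotP: x => x; rewrite -!quot_projZ scalerA. Qed.

Fact quot_scale1 : left_id 1 quot_scale.
Proof. by elim/quotP=> x; rewrite -quot_projZ scale1r. Qed.

Fact quot_scaleDr : right_distributive quot_scale +%R.
Proof.
move=> c; do 2![elim/quotP=> ?].
by rewrite -quot_projD -!quot_projZ scalerDr quot_projD.
Qed.

Fact quot_scaleDl (x : Q) : {morph quot_scale^~ x : a b / a + b}.
Proof.
by elim/quotP: x => x a b; rewrite -!quot_projZ scalerDl quot_projD.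
Qed.

HB.instance Definition _ := GRing.Zmodule_isLmodule.Build K Q
  quot_scaleA quot_scale1 quot_scaleDr quot_scaleDl.

Fact quot_scaleAl c (x y : Q) : c *: (x * y) = c *: x * y.
Proof.
elim/quotP: x => x; elim/quotP: y => y.
by rewrite -[_ * _]quot_projM -![_ *: quot_proj _]quot_projZ
  -[RHS]quot_projM scalerAl.
Qed.

Fact quot_scaleAr c (x y : Q) : c *: (x * y) = x * (c *: y).
Proof.
elim/quotP: x => x; elim/quotP: y => y.
by rewrite -[_ * _]quot_projM -![_ *: quot_proj _]quot_projZ
  -[RHS]quot_projM scalerAr.
Qed.

HB.instance Definition _ := GRing.Lmodule_isLalgebra.Build K Q quot_scaleAl.
HB.instance Definition _ := GRing.Lalgebra_isAlgebra.Build K Q quot_scaleAr.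

HB.instance Definition _ := GRing.isZmodMorphism.Build A Q quot_proj quot_projB.
HB.instance Definition _ := GRing.isMonoidMorphism.Build A Q quot_proj
  (erefl, quot_projM).
HB.instance Definition _ := GRing.isScalable.Build K A Q *:%R quot_proj
  quot_projZ.

End AlgQuot.

HB.mixin Record Vector_isLie (K : fieldType) L of Vector K L := {
  lie : L -> L -> L;
  lie_linearl : forall y, linear (lie^~ y);
  lie_linearr : forall x, linear (lie x);
  liexx : forall x, lie x x = 0;
  lie_jacobi : forall x y z,
    lie x (lie y z) + lie y (lie z x) + lie z (lie x y) = 0
}.

#[short(type="fdLieAlgType")]
HB.structure Definition FdLieAlgebra (K : fieldType) :=
  {L of Vector K L & Vector_isLie K L}.

Section Nilpotent.
Variables (K : fieldType) (G : fdLieAlgType K).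

(* By bilinearity, the brackets of basis vectors span the same subspace as all
   the brackets [x, y] with x in U and y in V. *)
Definition lie_vspace (U V : {vspace G}) : {vspace G} :=
  <<[seq lie x y | x <- vbasis U, y <- vbasis V]>>%VS.

Definition lower_central (n : nat) : {vspace G} :=
  iter n (lie_vspace fullv) fullv.

Definition lie_nilpotent : Prop := exists n, lower_central n = 0%VS.

End Nilpotent.

Section FreeAlgebra.
Variables (K : fieldType) (I : choiceType).

(* Noncommutative polynomials over K in the indeterminates I. *)
Definition free_alg : Type := {malg K[{fmonom I}]}.

HB.instance Definition _ := GRing.Lalgebra.on free_alg.

Fact free_alg_scaleAr c (x y : free_alg) : c *: (x * y) = x * (c *: y).
Proof.
rewrite [RHS](@malgMEw _ _ (msupp x) (msupp y)) ?msuppZ_le //.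
rewrite malgME scaler_sumr; apply: eq_bigr => i _.
rewrite scaler_sumr; apply: eq_bigr => j _.
by apply/malgP=> k; rewrite mcoeffZ !mcoeffU mcoeffZ mulrnAr mulrCA.
Qed.

HB.instance Definition _ :=
  GRing.Lalgebra_isAlgebra.Build K free_alg free_alg_scaleAr.

Definition free_gen (i : I) : free_alg := << fmu i >>%R.

End FreeAlgebra.

Section FreeLift.
Variables (K : fieldType) (I : choiceType) (B : algType K) (h : I -> B).

Definition mon_lift (m : {fmonom I}) : B := \prod_(i <- (m : seq I)) h i.

Fact mon_lift_mm : mmorphism mon_lift.
Proof.
split=> [x y|]; first by rewrite /mon_lift fmM big_cat.
by rewrite /mon_lift fm1 big_nil.
Qed.

HB.instance Definition _ :=
  isMultiplicative.Build {fmonom I} B mon_lift mon_lift_mm.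

Definition free_lift (g : free_alg K I) : B := mmap (in_alg B) mon_lift g.

Fact free_liftB : {morph free_lift : x y / x - y}.
Proof. exact: (raddfB (mmap (in_alg B) mon_lift)). Qed.

Fact free_liftM : monoid_morphism free_lift.
Proof.
have comm_h (g : {malg K[{fmonom I}]}) m m' :
  GRing.comm (in_alg B g@_m) (mon_lift m').
  by rewrite /GRing.comm /= mulr_algl mulr_algr.
by have [? ?] := commr_mmap_is_multiplicative comm_h; split.
Qed.

Fact free_liftZ : scalable free_lift.
Proof.
by move=> c x; rewrite /free_lift mmapZ /= mulr_algl.
Qed.

HB.instance Definition _ :=
  GRing.isZmodMorphism.Build _ _ free_lift free_liftB.
HB.instance Definition _ :=
  GRing.isMonoidMorphism.Build _ _ free_lift free_liftM.
HB.instance Definition _ :=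
  GRing.isScalable.Build K _ _ _ free_lift free_liftZ.

Lemma free_liftE i : free_lift (free_gen K i) = h i.
Proof.
by rewrite /free_lift mmapU /= scale1r mul1r /mon_lift fmU big_seq1.
Qed.

Lemma free_lift_uniq (f g : {lrmorphism free_alg K I -> B}) :
  (forall i, f (free_gen K i) = g (free_gen K i)) -> f =1 g.
Proof.
move=> fg x; pose mon s : free_alg K I := << FMonom s >>%R.
have fg_mon (s : seq I) : f (mon s) = g (mon s).
  elim: s => [|i s IH].
    by have -> : mon [::] = 1 by [rewrite /mon -fmoneE]; rewrite !rmorph1.
  have -> : mon (i :: s) = free_gen K i * mon s.
    rewrite [RHS]fgmulUU mulr1; congr (<< _ >>).
    by apply/eqP; rewrite fmP fmM fmU.
  by rewrite !rmorphM /=; congr (_ * _); [exact: fg | exact: IH].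
have -> : x = \sum_(k <- msupp x) (x@_k *: mon k).
  rewrite {1}[x]monalgE; apply: eq_bigr => k _.
  by apply/malgP => j; rewrite /mon fmK [RHS]mcoeffZ !mcoeffU mulr_natr.
rewrite !linear_sum; apply: eq_bigr => k _.
by rewrite !linearZ /=; congr (_ *: _); exact: fg_mon.
Qed.

End FreeLift.

Section Uenv.
Variables (K : fieldType) (G : fdLieAlgType K).

(* T(G), as the free algebra on the basis [vbasis {:G}] of G. *)
Definition tensor_alg : Type := free_alg K 'I_(\dim {:G}).

HB.instance Definition _ := GRing.Algebra.on tensor_alg.

Definition tensor_inj (x : G) : tensor_alg :=
  \sum_i coord (vbasis {:G}) i x *: (free_gen K i : tensor_alg).

Definition uenv_rel (x y : G) : tensor_alg :=
  tensor_inj x * tensor_inj y - tensor_inj y * tensor_inj x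
  - tensor_inj (lie x y).

(* The least two-sided ideal of T(G) containing all x y - y x - [x, y]. *)
Definition uenv_ideal : tensor_alg -> bool := fun t =>
  `[< forall I : {pred tensor_alg}, two_sided I ->
        (forall x y, uenv_rel x y \in I) -> t \in I >].

Fact uenv_ideal_two_sided : two_sided (uenv_ideal : {pred tensor_alg}).
Proof.
split=> [|a u /asboolP uJ|a u /asboolP uJ].
- split=> [|u v /asboolP uJ /asboolP vJ]; apply/asboolP=> I I2 IR.
    by case: I2 => -[].
  by case: (I2) => -[_ IB] _ _; apply: IB; [apply: uJ | apply: vJ].
- by apply/asboolP=> I I2 IR; case: (I2) => _ Il _; apply/Il/uJ.
- by apply/asboolP=> I I2 IR; case: (I2) => _ _ Ir; apply/Ir/uJ.
Qed.

Lemma uenv_rel_ideal x y : uenv_rel x y \in (uenv_ideal : {pred _}).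
Proof. by apply/asboolP=> I _; apply. Qed.

Fact uenv_ideal_proper : 1 \notin (uenv_ideal : {pred tensor_alg}).
Proof.
pose eps : tensor_alg -> K := @mcoeff {fmonom 'I_(\dim {:G})} K mone.
have epsM : {morph eps : x y / x * y} by exact: rmorphM.
have epsB : {morph eps : x y / x - y} by exact: raddfB.
have eps_inj x : eps (tensor_inj x) = 0.
  rewrite /eps raddf_sum big1 // => i _.
  by rewrite [LHS]mcoeffZ mcoeffU fm1_eq1 mulr0.
pose I : {pred tensor_alg} := [pred t | eps t == 0].
have IE t : (t \in I) = (eps t == 0) by [].
have I2 : two_sided I.
  split=> [|a u|a u]; rewrite ?IE.
  - split=> [|u v]; rewrite !IE; first by rewrite /eps mcoeff0.
    by rewrite epsB => /eqP-> /eqP->; rewrite subr0.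
  - by rewrite epsM => /eqP->; rewrite mulr0.
  - by rewrite epsM => /eqP->; rewrite mul0r.
have IR x y : uenv_rel x y \in I.
  rewrite IE /uenv_rel; move: (eps_inj x) (eps_inj y) (eps_inj (lie x y)).
  move: (tensor_inj x) (tensor_inj y) (tensor_inj (lie x y)) => u v w eu ev ew.
  by rewrite !epsB !epsM eu ev ew mulr0 !subr0.
apply/negP=> /asboolP/(_ I I2 IR).
by rewrite IE /eps mcoeff1 eqxx oner_eq0.
Qed.

HB.instance Definition _ := GRing.isZmodClosed.Build tensor_alg uenv_ideal
  (let: And3 h _ _ := uenv_ideal_two_sided in h).
HB.instance Definition _ := isProperIdeal.Build tensor_alg uenv_ideal
  (conj uenv_ideal_proper (let: And3 _ h _ := uenv_ideal_two_sided in h)).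
HB.instance Definition _ := isRightMulClosed.Build tensor_alg uenv_ideal
  (let: And3 _ _ h := uenv_ideal_two_sided in h).

Definition Uenv : Type := alg_quot uenv_ideal.

HB.instance Definition _ := GRing.Algebra.on Uenv.

Definition uenv_inj (x : G) : Uenv := quot_proj uenv_ideal (tensor_inj x).

Lemma uenv_inj_lie x y :
  uenv_inj (lie x y) = uenv_inj x * uenv_inj y - uenv_inj y * uenv_inj x.
Proof.
rewrite /uenv_inj -!rmorphM -rmorphB /=; apply/esym/eqP.
rewrite quot_projE; exact: uenv_rel_ideal.
Qed.

Lemma uenv_universal (B : algType K) (h : {linear G -> B})
  (hl : forall x y, h (lie x y) = h x * h y - h y * h x) :
  exists phi : {lrmorphism Uenv -> B},
    (forall x, phi (uenv_inj x) = h x) /\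
    forall psi : {lrmorphism Uenv -> B},
      (forall x, psi (uenv_inj x) = h x) -> psi =1 phi.
Proof.
pose h0 (i : 'I_(\dim {:G})) := h (vbasis {:G})`_i.
pose F : tensor_alg -> B := free_lift h0.
have FB : {morph F : x y / x - y} by exact: rmorphB.
have FM : {morph F : x y / x * y} by exact: rmorphM.
have F1 : F 1 = 1 by exact: rmorph1.
have FZ : forall c, {morph F : x / c *: x} by move=> c x; exact: linearZ.
have Finj x : F (tensor_inj x) = h x.
  rewrite [in RHS](coord_vbasis (memvf x)) linear_sum /F linear_sum.
  by apply: eq_bigr => i _; rewrite !linearZ; congr (_ *: _); exact: free_liftE.
have FI t : t \in (uenv_ideal : {pred _}) -> F t = 0.
  move=> /asboolP/(_ [pred t | F t == 0]) H; apply/eqP; apply: H.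
    split=> [|a u|a u]; rewrite /in_mem /=.
    - split=> [|u v]; rewrite /in_mem /=.
        by rewrite -[X in F X](subrr 0) FB subrr.
      by rewrite FB => /eqP-> /eqP->; rewrite subr0.
    - by rewrite FM => /eqP->; rewrite mulr0.
    - by rewrite FM => /eqP->; rewrite mul0r.
  move=> x y; rewrite /in_mem /= /uenv_rel.
  move: (Finj x) (Finj y) (Finj (lie x y)).
  move: (tensor_inj x) (tensor_inj y) (tensor_inj (lie x y)) => u v w eu ev ew.
  by rewrite !FB !FM eu ev ew hl subrr.
pose phi (z : Uenv) : B := F (repr z).
have phiE t : phi (quot_proj uenv_ideal t) = F t.
  apply/eqP; rewrite -subr_eq0 -FB; apply/eqP/FI.
  by rewrite -quot_projE quot_proj_repr.
have qP (T : Uenv -> Prop) :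
  (forall x, T (quot_proj uenv_ideal x)) -> forall x, T x.
  by move=> H x; rewrite -[x]quot_proj_repr; apply: H.
have phiB : {morph phi : x y / x - y}.
  by elim/qP=> x; elim/qP=> y; rewrite -quot_projB !phiE FB.
have phiM : monoid_morphism phi.
  split; first by rewrite -F1 -phiE.
  elim/qP=> x; elim/qP=> y; rewrite -[_ * _]quot_projM !phiE; exact: FM.
have phiZ : scalable phi.
  move=> c; elim/qP=> x; rewrite -[_ *: _]quot_projZ !phiE; exact: FZ.
pose p1 := GRing.isZmodMorphism.Build _ _ phi phiB.
pose p2 := GRing.isMonoidMorphism.Build _ _ phi phiM.
pose p3 := GRing.isScalable.Build K _ _ _ phi phiZ.
pose phiR : {lrmorphism Uenv -> B} := HB.pack phi p1 p2 p3.
exists phiR; split=> [x|psi psiE]; first by rewrite /= phiE Finj.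
elim/qP=> t; rewrite /= phiE.
pose g1 : tensor_alg -> B := fun t => psi (quot_proj uenv_ideal t).
have g1B : {morph g1 : x y / x - y}.
  by move=> x y; rewrite /g1 quot_projB rmorphB.
have g1M : monoid_morphism g1.
  by split; [exact: rmorph1 | move=> x y; rewrite /g1 quot_projM; exact: rmorphM].
have g1Z : scalable g1 by move=> c x; rewrite /g1 quot_projZ; exact: linearZ.
pose q1 := GRing.isZmodMorphism.Build _ _ g1 g1B.
pose q2 := GRing.isMonoidMorphism.Build _ _ g1 g1M.
pose q3 := GRing.isScalable.Build K _ _ _ g1 g1Z.
pose gR : {lrmorphism free_alg K 'I_(\dim {:G}) -> B} := HB.pack g1 q1 q2 q3.
apply: (@free_lift_uniq _ _ _ gR (free_lift h0)) => i /=.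
rewrite free_liftE /h0 -psiE /g1 /uenv_inj; congr (psi (quot_proj _ _)).
rewrite /tensor_inj (bigD1 i) //= big1 ?addr0.
  by rewrite coord_free ?eqxx ?scale1r // (basis_free (vbasisP _)).
move=> j ji; rewrite coord_free ?(basis_free (vbasisP _)) // eq_sym.
by rewrite (negbTE ji) scale0r.
Qed.

End Uenv.

Definition inner_der (R : nzRingType) (u : R) : R -> R :=
  fun b => u * b - b * u.

Definition is_eigenvalue (K : fieldType) (V : lmodType K) (phi : V -> V)
  (lambda : K) : Prop := exists2 v : V, v != 0 & phi v = lambda *: v.

(* Main.v *)
Require Import Defs.
From HB Require Import structures.
From mathcomp Require Import all_boot all_algebra.
From mathcomp Require Import finmap monalg boolp.

Set Implicit Arguments.
Unset Strict Implicit.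
Unset Printing Implicit Defensive.

Import GRing.Theory.
Local Open Scope ring_scope.

(** Write A for the prime factor ring and [u, v] for u v - v u. The proof equips
A with an N^n-valued degree with multiplicative central leading coefficients,
and then runs an infinite descent.

Since G is nilpotent, it is spanned by vectors x_1, ..., x_n such that each
bracket [G, x_i] lies in the span of x_1, ..., x_(i-1) ([ex_central_chain]).
Each ad x_i acts on A as a locally nilpotent derivation and preserves the
commutant of x_1, ..., x_(i-1). Given u <> 0, apply to it the last divided
power of ad x_1 that does not annihilate it, then the last divided power of
ad x_2 that does not annihilate the result, and so on. The
exponents used are the degree of u. The final value is its leading coefficient:
it is nonzero and commutes with x_1, ..., x_n ([ex_lead_commutant]), which
generate A, hence it is central ([rho_central]). By the Leibniz rule,
degrees add and leading coefficients multiply ([leadM]); and nonzero central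
elements of a prime ring are not zero divisors ([quot_central_regular]), so a
product of nonzero leading coefficients is nonzero.

Let now [f(a), w] = c w with w <> 0 and c <> 0. Then w' := [a, w] satisfies the
same equation, as a commutes with f(a), and w' <> 0, as otherwise w would
commute with f(a). With m the degree of f, the element [f(a), w] is a
combination of the a^i w' a^j with i + j < m. Those with i + j = m - 1 all have
the same leading coefficient z_a^(m-1) z_w', because leading coefficients are
central; so they add up, in characteristic zero they do not cancel, and they
dominate the others ([lead_inner_der_horner]). Comparing with c w,
  deg w = (m - 1) deg a + deg w'.
As a is not central, some coordinate of deg a is positive, and as m > 1 that
coordinate is strictly smaller for w' than for w. Replacing w by w' forever is
impossible ([inner_der_horner_eigen0]). *)

(** * Inner derivations *)

Section InnerDerivations.
Variables (K : fieldType) (R : algType K).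
Implicit Types (x u v w : R).

Fact inner_der_linear x : linear (inner_der x).
Proof.
by move=> c u v; rewrite /inner_der mulrDr mulrDl -scalerAr -scalerAl opprD
  addrACA scalerBr.
Qed.
HB.instance Definition _ x :=
  GRing.isLinear.Build K R R *:%R (inner_der x) (inner_der_linear x).

Lemma inner_derM x u v :
  inner_der x (u * v) = inner_der x u * v + u * inner_der x v.
Proof. by rewrite /inner_der mulrBl mulrBr !mulrA addrA subrK. Qed.

Lemma inner_der_eq0 x u : inner_der x u = 0 <-> x * u = u * x.
Proof.
by rewrite /inner_der; split=> [/eqP|->]; rewrite ?subrr // subr_eq0 => /eqP.
Qed.

Lemma inner_derN x u : inner_der x u = - inner_der u x.
Proof. by rewrite /inner_der opprB. Qed.

Lemma inner_der1 x : inner_der x 1 = 0.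
Proof. by apply/inner_der_eq0; rewrite mulr1 mul1r. Qed.

Lemma inner_der_jacobi x y u : inner_der y (inner_der x u) =
  inner_der (inner_der y x) u + inner_der x (inner_der y u).
Proof.
rewrite [X in inner_der y X]/inner_der linearB /= !inner_derM.
by rewrite opprD [X in _ + X]addrC addrACA.
Qed.

(** What lets the leading coefficient stay in the commutant of the previous
elements of the chain while ad x is being applied. *)
Lemma inner_der_commutant x y u : y * u = u * y ->
  inner_der y x * u = u * inner_der y x ->
  y * inner_der x u = inner_der x u * y.
Proof.
move=> yu yxu; apply/inner_der_eq0.
rewrite inner_der_jacobi (inner_der_eq0 y u).2 // linear0 addr0.
exact/inner_der_eq0.
Qed.

Fact iter_inner_der_linear x n : linear (iter n (inner_der x)).
Proof. by elim: n => // n IH c u v; rewrite !iterS IH linearP. Qed.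
HB.instance Definition _ x n := GRing.isLinear.Build K R R *:%R
  (iter n (inner_der x)) (@iter_inner_der_linear x n).

Lemma iter_inner_der_eq0 x m n u : (m <= n)%N ->
  iter m (inner_der x) u = 0 -> iter n (inner_der x) u = 0.
Proof. by move=> le_mn u0; rewrite -(subnK le_mn) iterD u0 linear0. Qed.

(** In the Leibniz expansion of the (m + n)-th iterate only one term has both of
its factors differentiated at most m, respectively n, times. *)
Lemma iter_inner_derM x m n u v :
  iter m.+1 (inner_der x) u = 0 -> iter n.+1 (inner_der x) v = 0 ->
  iter (m + n) (inner_der x) (u * v) =
    (iter m (inner_der x) u * iter n (inner_der x) v) *+ 'C(m + n, m).
Proof.
have left0 k u' v' : inner_der x u' = 0 ->
    iter k (inner_der x) (u' * v') = u' * iter k (inner_der x) v'.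
  move=> u0; elim: k => // k IH.
  by rewrite !iterS IH inner_derM u0 mul0r add0r.
have right0 k u' v' : inner_der x v' = 0 ->
    iter k (inner_der x) (u' * v') = iter k (inner_der x) u' * v'.
  move=> v0; elim: k => // k IH.
  by rewrite !iterS IH inner_derM v0 mulr0 addr0.
move Ek: (m + n)%N => k; elim: k m n u v Ek => [|k IH] m n u v.
  by case: m n => [|m] [|n].
case: m => [|m].
  by rewrite add0n => -> u0 _; rewrite left0 // bin0.
case: n => [|n].
  by rewrite addn0 => -> _ v0; rewrite right0 // binn.
move=> Ek u0 v0; rewrite iterSr inner_derM linearD /=.
have Ekl : (m + n.+1 = k)%N by apply: succn_inj.
have Ekr : (m.+1 + n = k)%N by rewrite -Ekl addnS.
rewrite (IH m n.+1) -?iterSr // (IH m.+1 n) -?iterSr // -mulrnDr.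
by rewrite binS addnC.
Qed.

Lemma iter_inner_derMS x m n u v :
  iter m.+1 (inner_der x) u = 0 -> iter n.+1 (inner_der x) v = 0 ->
  iter (m + n).+1 (inner_der x) (u * v) = 0.
Proof.
move=> u0 v0; rewrite iterS iter_inner_derM // raddfMn /= inner_derM.
by rewrite -!iterS u0 v0 mulr0 mul0r addr0 mul0rn.
Qed.

(** * Degrees and leading coefficients *)

Section LeadingCoefficients.
Hypothesis charK : [pchar K] =i pred0.

(** [lead xs d u z]: with respect to the lexicographic order given by [xs], the
degree of [u] is at most [d], and [z] is the coefficient of [u] in degree [d].
That coefficient may be zero, so that the elements of lower degree are those
with coefficient 0. Dividing by factorials makes [z] multiplicative in [u].
Letting [d] be a function on all of nat makes degrees add pointwise, whatever
the length of [xs]. *)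
Fixpoint lead (xs : seq R) (d : nat -> nat) (u z : R) : Prop :=
  if xs is x :: xs' then
    iter (d 0%N).+1 (inner_der x) u = 0 /\
    lead xs' (fun k => d k.+1)
      (((d 0%N)`!)%:R^-1 *: iter (d 0%N) (inner_der x) u) z
  else u = z.

Lemma eq_lead xs d e u z : d =1 e -> lead xs d u z -> lead xs e u z.
Proof.
elim: xs d e u => //= x xs IH d e u de; rewrite -(de 0%N) => -[-> ulead].
by split=> //; apply: IH ulead => k.
Qed.

Lemma lead0 xs d : lead xs d 0 0.
Proof. by elim: xs d => //= x xs IH d; rewrite !linear0. Qed.

Lemma lead_linear xs d c u v z t :
  lead xs d u z -> lead xs d v t -> lead xs d (c *: u + v) (c *: z + t).
Proof.
elim: xs d u v => [|x xs IH] d u v; first by move=> /= -> ->.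
move=> [u0 ulead] [v0 vlead].
split; first by rewrite iter_inner_der_linear u0 v0 scaler0 addr0.
by rewrite iter_inner_der_linear scalerDr scalerA mulrC -scalerA; apply: IH.
Qed.

Lemma lead_sum xs d (I : Type) (r : seq I) (c : I -> K) (u z : I -> R) :
  (forall i, lead xs d (u i) (z i)) ->
  lead xs d (\sum_(i <- r) c i *: u i) (\sum_(i <- r) c i *: z i).
Proof.
move=> ulead; elim: r => [|i r IH]; first by rewrite !big_nil; apply: lead0.
by rewrite !big_cons; apply: lead_linear.
Qed.

Lemma leadM xs d e u v z t :
  lead xs d u z -> lead xs e v t ->
  lead xs (fun k => d k + e k)%N (u * v) (z * t).
Proof.
elim: xs d e u v => [|x xs IH] d e u v; first by move=> /= -> ->.
move=> [u0 ulead] [v0 vlead].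
split; first exact: iter_inner_derMS.
have := IH _ _ _ _ ulead vlead.
rewrite -scalerAl -scalerAr scalerA /= iter_inner_derM //.
set w := iter _ _ u * iter _ _ v; congr (lead _ _ _ _).
rewrite -[w *+ _]scaler_nat scalerA; congr (_ *: _).
have nz n : (0 < n)%N -> n%:R != 0 :> K.
  by rewrite (pcharf0P K).1 // lt0n.
have /(congr1 (fun n => n%:R : K)) := bin_fact (leq_addr (e 0%N) (d 0%N)).
rewrite addKn !natrM => /(canRL (mulfK _)) ->.
- by rewrite invfM mulrA mulVf ?mul1r ?nz ?fact_gt0.
by rewrite mulf_neq0 ?nz ?fact_gt0.
Qed.

Lemma leadX xs d u z k :
  lead xs d u z -> lead xs (fun i => k * d i)%N (u ^+ k) (z ^+ k).
Proof.
move=> ulead; elim: k => [|k IH].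
  rewrite !expr0; elim: xs d {ulead} => //= x xs IH d.
  rewrite inner_der1 fact0 invr1 scale1r.
  by split=> //; apply: (IH (fun k => d k.+1)).
rewrite !exprS; apply: eq_lead (leadM ulead IH) => i.
by rewrite mulSn.
Qed.

(** Multiplying by this turns a coefficient in one degree into the zero
coefficient in any larger degree, so no explicit order on degrees is needed. *)
Lemma lead1_eq0 xs d k : (k < size xs)%N -> (0 < d k)%N -> lead xs d 1 0.
Proof.
have der1 x n : (0 < n)%N -> iter n (inner_der x) 1 = 0.
  by move=> n0; apply: (@iter_inner_der_eq0 x 1); rewrite // /= inner_der1.
elim: xs d k => //= x xs IH d k k_lt dk.
split; first by rewrite -iterS der1.
case: (posnP (d 0%N)) => [d0|d0]; last by rewrite der1 // scaler0; apply: lead0.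
rewrite d0 fact0 invr1 scale1r /=.
by case: k k_lt dk => [|k] k_lt dk; [rewrite d0 in dk | apply: (IH _ k)].
Qed.

Lemma lead_degree_uniq xs d e u z t :
  lead xs d u z -> z != 0 -> lead xs e u t -> t != 0 ->
  forall k, (k < size xs)%N -> d k = e k.
Proof.
have lead0E ys c y : lead ys c 0 y -> y = 0.
  elim: ys c => //= x ys IH c [_]; rewrite linear0 scaler0; exact: IH.
elim: xs d e u => //= x xs IH d e u [u0 ulead] nz [v0 vlead] nt.
have de : d 0%N = e 0%N.
  case: (ltngtP (d 0%N) (e 0%N)) => // lt_de.
    move: vlead; rewrite (iter_inner_der_eq0 lt_de) // scaler0.
    by move/lead0E=> /eqP; rewrite (negPf nt).
  move: ulead; rewrite (iter_inner_der_eq0 lt_de) // scaler0.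
  by move/lead0E=> /eqP; rewrite (negPf nz).
move=> [|k] //; rewrite ltnS => k_lt.
by rewrite -de in vlead; apply: (IH _ _ _ ulead nz vlead nt).
Qed.

Lemma lead_degree0 xs d u z :
  (forall k, (k < size xs)%N -> d k = 0%N) -> lead xs d u z -> u = z.
Proof.
elim: xs d u => //= x xs IH d u d0 [_].
rewrite d0 //= fact0 invr1 scale1r; apply: IH => k k_lt; exact: (d0 k.+1).
Qed.

Lemma inner_der_exprS a k w :
  inner_der (a ^+ k.+1) w = inner_der a w * a ^+ k + a * inner_der (a ^+ k) w.
Proof.
by rewrite inner_derN exprS inner_derM opprD -mulNr -mulrN -!inner_derN.
Qed.

Lemma inner_der_horner a (f : {poly K}) w :
  inner_der (horner_alg a f) w =
  \sum_(i < size f) f`_i *: inner_der (a ^+ i) w.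
Proof.
have -> : horner_alg a f = \sum_(i < size f) f`_i *: a ^+ i.
  rewrite -[f in LHS]coefK poly_def linear_sum; apply: eq_bigr => i _ /=.
  by rewrite linearZ /= rmorphXn /= horner_algX mulr_algl.
rewrite inner_derN linear_sum -sumrN; apply: eq_bigr => i _.
by rewrite linearZ /= -scalerN -inner_derN.
Qed.

Lemma inner_der_horner_eq0 a (f : {poly K}) u :
  a * u = u * a -> inner_der (horner_alg a f) u = 0.
Proof.
move=> au; rewrite inner_der_horner big1 // => i _.
by rewrite (inner_der_eq0 _ _).2 ?scaler0 //; apply/esym/commrX/esym.
Qed.

Definition central z := forall u, z * u = u * z.

Lemma centralX z k : central z -> central (z ^+ k).
Proof. by move=> zC u; apply/esym/commrX; rewrite /GRing.comm zC. Qed.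

(** [a^(k+1), w] is the sum of the a^i [a, w] a^j with i + j = k; all k + 1 of
them have the same leading coefficient, since [z] is central. *)
Lemma lead_inner_der_expr xs d e a w z t k : central z ->
  lead xs d a z -> lead xs e (inner_der a w) t ->
  lead xs (fun i => k * d i + e i)%N (inner_der (a ^+ k.+1) w)
    ((z ^+ k * t) *+ k.+1).
Proof.
move=> zC alead wlead; elim: k => [|k IH]; first by rewrite expr1 mul1r.
rewrite inner_der_exprS mulrS -[X in lead _ _ (X + _)]scale1r.
rewrite -[X in lead _ _ _ (X + _)]scale1r.
apply: lead_linear.
  rewrite (centralX _ zC); apply: eq_lead (leadM wlead (leadX k.+1 alead)) => i.
  by rewrite addnC.
rewrite [z ^+ _]exprS -mulrA -mulrnAr; apply: eq_lead (leadM alead IH) => i.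
by rewrite mulSn addnA.
Qed.

(** Only the leading term of [f] contributes in degree n d + e: the positivity
of [d k] puts the terms with smaller powers of [a] in strictly lower degree. *)
Lemma lead_inner_der_horner xs d e a w z t (f : {poly K}) n k :
  size f = n.+2 -> central z -> (k < size xs)%N -> (0 < d k)%N ->
  lead xs d a z -> lead xs e (inner_der a w) t ->
  lead xs (fun i => n * d i + e i)%N (inner_der (horner_alg a f) w)
    (lead_coef f *: ((z ^+ n * t) *+ n.+1)).
Proof.
move=> szf zC k_lt dk alead wlead.
pose y i : R := if i == n.+1 then (z ^+ n * t) *+ n.+1 else 0.
have -> : lead_coef f *: ((z ^+ n * t) *+ n.+1) = \sum_(i < size f) f`_i *: y i.
  rewrite szf big_ord_recr big1 /= => [|i _]; last first.
    by rewrite /y ltn_eqF ?scaler0.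
  by rewrite /y eqxx add0r lead_coefE szf.
rewrite inner_der_horner; apply: lead_sum => i; rewrite /y.
have [->|ne_i] := eqVneq; first exact: lead_inner_der_expr.
have: (i < n.+1)%N by rewrite ltn_neqAle ne_i -ltnS -szf ltn_ord.
case: {ne_i}(i : nat) => [_|m m_lt].
  by rewrite inner_derN expr0 inner_der1 oppr0; apply: lead0.
have m_le := ltnW (m_lt : (m < n)%N).
(* The difference of the degrees of the m-th and the n-th terms. *)
have low : lead xs (fun i => (n - m) * d i)%N 1 0.
  by apply: (lead1_eq0 k_lt); rewrite muln_gt0 subn_gt0 dk andbT.
rewrite -[X in lead _ _ X]mul1r -[0](mul0r ((z ^+ m * t) *+ m.+1)).
apply: eq_lead (leadM low (lead_inner_der_expr m zC alead wlead)) => j.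
by rewrite addnA -mulnDl subnK.
Qed.

(** The descent: [w] is replaced by [a, w], an eigenvector for the same
eigenvalue whose degree is smaller in a coordinate where [a] has positive
degree. *)
Lemma inner_der_horner_eigen0 (xs : seq R) :
  (forall z u, central z -> z != 0 -> z * u = 0 -> u = 0) ->
  (forall u, u != 0 -> exists d z, [/\ central z, z != 0 & lead xs d u z]) ->
  forall (a : R) (f : {poly K}) (c : K) (w : R),
  (1 < (size f).-1)%N -> w != 0 ->
  inner_der (horner_alg a f) w = c *: w -> c = 0.
Proof.
move=> reg ex_lead a f c w degf nz_w eig; apply/eqP/negPn/negP => nz_c.
have [n [szf n_gt0]] : exists n, size f = n.+2 /\ (0 < n)%N.
  by case: (size f) degf => [|[|[|n]]] // _; exists n.+1.
have next u : u != 0 -> inner_der (horner_alg a f) u = c *: u ->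
    inner_der a u != 0.
  move=> nz_u eig_u; apply/eqP=> /inner_der_eq0 au.
  have: c *: u == 0 by rewrite -eig_u inner_der_horner_eq0.
  by rewrite scaler_eq0 (negPf nz_c) (negPf nz_u).
have nz_a : a != 0.
  apply: contraNneq (next w nz_w eig) => ->.
  by rewrite /inner_der mul0r mulr0 subrr.
have [d [z [zC nz_z alead]]] := ex_lead a nz_a.
(* An element of degree zero is its own leading coefficient, hence central. *)
have [k k_lt dk] : exists2 k, (k < size xs)%N & (0 < d k)%N.
  apply: contrapT => no_k; have az : a = z.
    apply: (lead_degree0 _ alead) => k k_lt; apply: contrapT => dk.
    by apply: no_k; exists k; rewrite // lt0n; apply/eqP.
  by have /eqP[] := next w nz_w eig; apply/inner_der_eq0; rewrite az.
have [e [t [_ nz_t wlead]]] := ex_lead w nz_w.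
move Em: (e k) => m.
elim/ltn_ind: m e t w nz_w eig nz_t wlead Em.
move=> m IH e t w nz_w eig nz_t wlead Em.
have nz_w' := next w nz_w eig.
have eig' : inner_der (horner_alg a f) (inner_der a w) = c *: inner_der a w.
  rewrite inner_der_jacobi inner_der_horner_eq0 // eig linearZ.
  by rewrite [inner_der 0 w]inner_derN linear0 oppr0 add0r.
have [e' [t' [_ nz_t' w'lead]]] := ex_lead _ nz_w'.
have := lead_inner_der_horner szf zC k_lt dk alead w'lead; rewrite eig => w1.
have w2 : lead xs e (c *: w) (c *: t).
  by have := lead_linear c wlead (lead0 xs e); rewrite !addr0.
have nz1 : lead_coef f *: (z ^+ n * t' *+ n.+1) != 0.
  rewrite -scaler_nat !scaler_eq0 lead_coef_eq0 -size_poly_eq0 szf.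
  rewrite (pcharf0P K).1 //=; apply/eqP=> zt0; move/eqP: nz_t'; apply.
  elim: n zt0 {szf n_gt0 w1} => [|n IHn]; first by rewrite mul1r.
  by rewrite exprS -mulrA => /(reg _ _ zC nz_z).
have nz2 : c *: t != 0 by rewrite scaler_eq0 negb_or nz_c.
have Ek := lead_degree_uniq w1 nz1 w2 nz2 k_lt.
apply: (IH _ _ _ _ _ nz_w' eig' nz_t' w'lead erefl).
by rewrite -Em -Ek -[ltnLHS]add0n ltn_add2r muln_gt0 n_gt0.
Qed.
End LeadingCoefficients.
End InnerDerivations.

(** * Central chains in a nilpotent Lie algebra *)

Section LieBracket.
Variables (K : fieldType) (G : fdLieAlgType K).
Implicit Types (x y : G) (V : {vspace G}) (xs : seq G).

HB.instance Definition _ x :=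
  GRing.isLinear.Build K G G *:%R (lie x) (lie_linearr x).

Lemma lie_suml (I : Type) (r : seq I) (c : I -> K) (v : I -> G) y :
  lie (\sum_(i <- r) c i *: v i) y = \sum_(i <- r) c i *: lie (v i) y.
Proof.
elim: r => [|i r IH]; last by rewrite !big_cons lie_linearl IH.
rewrite !big_nil; have := lie_linearl y (-1) 0 0.
by rewrite scaler0 addr0 scaleN1r addNr.
Qed.

Lemma lie_lower_central x y n :
  y \in lower_central G n -> lie x y \in lower_central G n.+1.
Proof.
move=> yV; rewrite (coord_vbasis (memvf x)) lie_suml.
apply: memv_suml => i _; apply: memvZ.
rewrite (coord_vbasis yV) linear_sum; apply: memv_suml => j _.
rewrite linearZ; apply/memvZ/memv_span/allpairs_f;
  by rewrite mem_nth ?size_tuple.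
Qed.

(** [xs] extends a generating family of [V] to one of the whole algebra, each
new vector being central modulo the span of [V] and the vectors before it. *)
Fixpoint central_chain V xs : Prop :=
  if xs is x :: xs' then
    (forall y, lie y x \in V) /\ central_chain (V + <[x]>)%VS xs'
  else V = fullv.

(** Adding to [V] a basis of the preceding term of the lower central series
keeps the chain central, because the brackets with that term already lie in
[V]. *)
Lemma ex_central_chain V n :
  (lower_central G n <= V)%VS -> exists xs, central_chain V xs.
Proof.
elim: n V => [|n IH] V sub_V.
  by exists [::]; apply/eqP; rewrite eqEsubv subvf.
have [xs] := IH (V + lower_central G n)%VS (addvSr _ _).
rewrite -[lower_central G n in X in X -> _](span_basis (vbasisP _)).
have: {subset tval (vbasis (lower_central G n)) <= lower_central G n}.
  by move=> x; apply: vbasis_mem.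
elim: (tval _) V sub_V => [|x s IHs] V sub_V sub_s xs_chain.
  by exists xs; rewrite span_nil addv0 in xs_chain.
rewrite span_cons addvA in xs_chain.
have [||ys ys_chain] := IHs _ _ _ xs_chain.
- exact: subv_trans (addvSl _ _).
- by move=> y ys; apply: sub_s; apply: mem_behead.
exists (x :: ys); split=> // y; apply: (subvP sub_V).
by apply/lie_lower_central/sub_s/mem_head.
Qed.

(** * Algebras generated by a nilpotent Lie algebra *)

Section Representation.
Variables (R : algType K) (rho : {linear G -> R}).
Hypothesis charK : [pchar K] =i pred0.
Hypothesis rho_lie : forall x y, rho (lie x y) = inner_der (rho x) (rho y).

(** The degree is found greedily: the last iterate of ad [rho x] that does not
annihilate [u] commutes with [rho x], and still with the image of [V] because
[x] is central modulo [V]. At the end of the chain it commutes with everything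
in the image of [rho]. *)
Lemma ex_lead_commutant V xs u :
  (forall x u, exists n, iter n (inner_der (rho x)) u = 0) ->
  central_chain V xs ->
  (forall y, y \in V -> rho y * u = u * rho y) -> u != 0 ->
  exists d z, [/\ forall y, rho y * z = z * rho y, z != 0
    & lead (map rho xs) d u z].
Proof.
move=> nilp; elim: xs V u => /= [|x xs IH] V u.
  move=> -> comm_u nz_u; exists (fun=> 0%N), u.
  by split=> // y; apply/comm_u/memvf.
move=> [xV chain] comm_u nz_u.
have ex_n : exists n, iter n (inner_der (rho x)) u == 0.
  by have [n n0] := nilp x u; exists n; apply/eqP.
case: (ex_minnP ex_n) => -[|n] /= /eqP n0 n_min.
  by rewrite n0 eqxx in nz_u.
have {n_min} nz_n : iter n (inner_der (rho x)) u != 0.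
  by apply/negP=> /n_min; rewrite ltnn.
have comm_iter k y : y \in V ->
    let v := iter k (inner_der (rho x)) u in rho y * v = v * rho y.
  elim: k y => [|k IHk] y yV; first exact: comm_u.
  by apply: inner_der_commutant; rewrite -?rho_lie; apply: IHk.
have nz_c : (n`!%:R^-1 : K) != 0.
  by rewrite invr_eq0 (pcharf0P K).1 // -lt0n fact_gt0.
have [||d [z [zC nz_z ulead]]] :=
  IH _ (n`!%:R^-1 *: iter n (inner_der (rho x)) u) chain.
- move=> y /memv_addP[v vV [_ /vlineP[c ->] ->]].
  rewrite -scalerAl -scalerAr; congr (_ *: _).
  rewrite linearD linearZ mulrDl mulrDr comm_iter // -scalerAl -scalerAr.
  by congr (_ + _ *: _); apply/inner_der_eq0.
- by rewrite scaler_eq0 negb_or nz_c.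
by exists (fun k => if k is k'.+1 then d k' else n), z; split.
Qed.

(* The image of [rho] generates [R] as an algebra, as an induction principle. *)
Hypothesis rho_gen : forall S : R -> Prop,
  S 1 -> (forall c u v, S u -> S v -> S (c *: u + v)) ->
  (forall u v, S u -> S v -> S (u * v)) -> (forall x, S (rho x)) ->
  forall u, S u.

Lemma rho_central (z : R) : (forall x, rho x * z = z * rho x) -> central z.
Proof.
move=> zG; apply: (@rho_gen (fun u => z * u = u * z)) =>
  [|c u v zu zv|u v zu zv|x].
- by rewrite mulr1 mul1r.
- by rewrite mulrDl mulrDr -scalerAl -scalerAr zu zv.
- by rewrite mulrA zu -mulrA zv mulrA.
- by rewrite zG.
Qed.

(** By the Leibniz rule the elements killed by a power of ad [rho x] form a
subalgebra; it contains the generators since the Lie algebra is nilpotent. *)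
Lemma rho_inner_der_nilp : lie_nilpotent G -> forall x u,
  exists n, iter n (inner_der (rho x)) u = 0.
Proof.
move=> [N nilG] x.
apply: rho_gen => [|c u v [m um] [n vn]|u v [m um] [n vn]|y].
- by exists 1%N; rewrite /= inner_der1.
- exists (m + n)%N; rewrite iter_inner_der_linear.
  rewrite (iter_inner_der_eq0 (leq_addr n m) um).
  by rewrite (iter_inner_der_eq0 (leq_addl m n) vn) scaler0 addr0.
- exists (m + n).+1.
  by apply: iter_inner_derMS; rewrite iterS ?um ?vn linear0.
exists N; have -> : iter N (inner_der (rho x)) (rho y) = rho (iter N (lie x) y).
  by elim: N {nilG} => // N IH; rewrite !iterS IH rho_lie.
suff /eqP -> : iter N (lie x) y == 0 by rewrite linear0.
rewrite -memv0 -nilG; elim: N {nilG} => [|N IH]; first exact: memvf.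
exact: lie_lower_central.
Qed.

Lemma rho_eigen0 : lie_nilpotent G ->
  (forall z u : R, central z -> z != 0 -> z * u = 0 -> u = 0) ->
  forall (a : R) (f : {poly K}) (c : K) (w : R),
  (1 < (size f).-1)%N -> w != 0 ->
  inner_der (horner_alg a f) w = c *: w -> c = 0.
Proof.
move=> nilG reg a f c w degf nz_w eig; have [N nil0] := nilG.
have [xs chain] : exists xs : seq G, central_chain 0 xs.
  by apply: (@ex_central_chain _ N); rewrite nil0 subvv.
apply: (inner_der_horner_eigen0 charK (xs := map rho xs) reg _ degf nz_w eig).
move=> u nz_u.
have [|d [z [zC nz_z ulead]]] :=
  ex_lead_commutant (rho_inner_der_nilp nilG) chain _ nz_u.
  by move=> y; rewrite memv0 => /eqP ->; rewrite linear0 mul0r mulr0.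
by exists d, z; split=> //; apply: rho_central.
Qed.
End Representation.
End LieBracket.

(** * Prime quotients of the enveloping algebra *)

(** For central [z] the multiples of [z] and the annihilator of [z] are
two-sided ideals of the quotient with zero product, so primeness kills one of
them. *)
Lemma quot_central_regular (K : fieldType) (B : algType K) (P : ideal2 B) :
  prime_ideal P -> forall z u : alg_quot P,
  central z -> z != 0 -> z * u = 0 -> u = 0.
Proof.
move=> primeP z u zC nz_z zu.
pose pi : B -> alg_quot P := quot_proj P.
pose I : {pred B} := fun s => `[< exists t, pi s = t * z >].
pose J : {pred B} := fun s => `[< z * pi s = 0 >].
have I2 : two_sided I.
  split=> [|a s /asboolP[t st]|a s /asboolP[t st]].
  - split=> [|s s' /asboolP[t st] /asboolP[t' st']]; apply/asboolP.
      by exists 0; rewrite mul0r /pi linear0.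
    by exists (t - t'); rewrite mulrBl -st -st' /pi linearB.
  - by apply/asboolP; exists (pi a * t); rewrite /pi rmorphM /= -/pi st mulrA.
  - apply/asboolP; exists (t * pi a).
    by rewrite /pi rmorphM /= -/pi st -!mulrA zC.
have J2 : two_sided J.
  split=> [|a s /asboolP zs|a s /asboolP zs].
  - split=> [|s s' /asboolP zs /asboolP zs']; apply/asboolP.
      by rewrite /pi linear0 mulr0.
    by rewrite /pi linearB mulrBr /= zs zs' subrr.
  - by apply/asboolP; rewrite /pi rmorphM mulrA zC -mulrA zs mulr0.
  - by apply/asboolP; rewrite /pi rmorphM mulrA zs mul0r.
have in_P s : (s \in (P : {pred _})) = (pi s == 0).
  by rewrite -[0](linear0 (quot_proj P)) quot_projE subr0.
have [|IP|JP] := primeP I J I2 J2.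
- move=> s s' /asboolP[t st] /asboolP zs'.
  by rewrite in_P /pi rmorphM /= -/pi st -mulrA zs' mulr0.
- have: repr z \in I.
    by apply/asboolP; exists 1; rewrite mul1r /pi quot_proj_repr.
  by move/IP; rewrite in_P /pi quot_proj_repr (negPf nz_z).
have: repr u \in J by apply/asboolP; rewrite /pi quot_proj_repr.
by move/JP; rewrite in_P /pi quot_proj_repr => /eqP.
Qed.

Section EnvelopingQuotient.
Variables (K : fieldType) (G : fdLieAlgType K) (P : ideal2 (Uenv G)).
Local Notation A := (alg_quot P).

Definition quot_inj (x : G) : A := quot_proj P (uenv_inj x).

Fact quot_inj_linear : linear quot_inj.
Proof.
move=> c x y; rewrite /quot_inj /uenv_inj.
have -> : tensor_inj (c *: x + y) = c *: tensor_inj x + tensor_inj y.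
  rewrite /tensor_inj scaler_sumr -big_split; apply: eq_bigr => i _ /=.
  by rewrite linearP scalerDl scalerA.
by rewrite !linearP.
Qed.
HB.instance Definition _ :=
  GRing.isLinear.Build K G A *:%R quot_inj quot_inj_linear.

Lemma quot_inj_lie x y :
  quot_inj (lie x y) = inner_der (quot_inj x) (quot_inj y).
Proof.
rewrite /quot_inj uenv_inj_lie; move: (uenv_inj x) (uenv_inj y) => u v.
by rewrite quot_projB !quot_projM.
Qed.

(** The quotient is spanned by the images of the monomials of the free algebra,
and the free indeterminates are the images of the basis vectors of [G]. *)
Lemma quot_ind (S : A -> Prop) :
  S 1 -> (forall c u v, S u -> S v -> S (c *: u + v)) ->
  (forall u v, S u -> S v -> S (u * v)) -> (forall x, S (quot_inj x)) ->
  forall u, S u.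
Proof.
move=> S1 SP SM Sinj.
pose pi (t : tensor_alg G) : A := quot_proj P (quot_proj (@uenv_ideal K G) t).
(* Through [pi] the two nested quotients are only seen as one morphism. *)
have pi1 : pi 1 = 1 by [].
have piM u v : pi (u * v) = pi u * pi v.
  rewrite /pi (quot_projM _ u v); exact: quot_projM.
have piP c u v : pi (c *: u + v) = c *: pi u + pi v.
  rewrite /pi quot_projD quot_projZ.
  move: (quot_proj _ u) (quot_proj _ v) => u' v'.
  by rewrite (quot_projD P) (quot_projZ P).
have pi0 : pi 0 = 0.
  by have := piP (-1) 0 0; rewrite !scaleN1r !addNr.
have S0 : S 0 by rewrite -(addNr 1) -scaleN1r; apply: SP.
have Sgen i : S (pi (free_gen K i)).
  suff -> : free_gen K i = tensor_inj (vbasis {:G})`_i by apply: Sinj.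
  rewrite /tensor_inj (bigD1 i) //= big1 ?addr0.
    by rewrite coord_free ?eqxx ?scale1r // (basis_free (vbasisP _)).
  move=> j ji; rewrite coord_free ?(basis_free (vbasisP _)) // eq_sym.
  by rewrite (negbTE ji) scale0r.
have Smon (s : seq 'I_(\dim {:G})) : S (pi << FMonom s >>%R).
  elim: s => [|i s IH].
    have -> : << FMonom [::] >>%R = 1 :> tensor_alg G by rewrite -fmoneE.
    by rewrite pi1.
  have -> : << FMonom (i :: s) >>%R =
      (free_gen K i : tensor_alg G) * << FMonom s >>%R.
    rewrite [RHS]fgmulUU mulr1; congr (<< _ >>).
    by apply/eqP; rewrite fmP fmM fmU.
  by rewrite piM; apply: SM.
move=> u; rewrite -[u]quot_proj_repr -[repr u]quot_proj_repr.
move: (repr _) => t; rewrite -/(pi t).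
have -> : t = \sum_(k <- msupp t) (t@_k *: (<< FMonom k >>%R : tensor_alg G)).
  rewrite {1}[t]monalgE; apply: eq_bigr => k _.
  by apply/malgP => j; rewrite fmK [RHS]mcoeffZ !mcoeffU mulr_natr.
elim: (enum_fset _) => [|k s IH]; first by rewrite big_nil pi0.
by rewrite big_cons piP; apply: SP.
Qed.

End EnvelopingQuotient.

Theorem corollary2p3 (K : fieldType) (charK : [pchar K] =i pred0)
  (G : fdLieAlgType K) (nilG : lie_nilpotent G)
  (P : ideal2 (Uenv G)) (primeP : prime_ideal P)
  (ncA : exists x y : alg_quot P, x * y != y * x)
  (a : alg_quot P) (f : {poly K}) (degf : (1 < (size f).-1)%N) (lambda : K) :
  is_eigenvalue (inner_der (horner_alg a f)) lambda <-> lambda = 0.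
Proof.
split=> [[w nz_w eig]|->]; last first.
  by exists 1; rewrite ?oner_eq0 // scale0r inner_der1.
exact: (rho_eigen0 charK (@quot_inj_lie _ _ P) (@quot_ind _ _ P) nilG
  (quot_central_regular primeP) degf nz_w eig).
Qed.
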